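(* For every $\omega\in\{\mathbf{0},\mathbf{1},\mathbf{2}\}^{\mathbb{N}_+}$, the Grigorchuk group $G_\omega$ embeds in the commutator subgroup $[[\psi]]'$ of the topological full group $[[\psi]]$ of some minimal subshift $(Y,\psi)$.
   Context: Cantor minimal systems and topological full groups. A Cantor minimal system is a pair $(X,\varphi)$ where $X$ is a compact space homeomorphic to the Cantor set and $\varphi$ is a homeomorphism of $X$ all of whose orbits are dense. Its topological full group $[[\varphi]]$ is the group of all homeomorphisms $g$ of $X$ for which there is a continuous function $n:X\to\mathbb{Z}$ with $g(x)=\varphi^{n(x)}(x)$ for every $x\in X$. A subshift over a finite alphabet $\mathcal{A}$ is a closed shift-invariant subset $X\subset\mathcal{A}^{\mathbb{Z}}$ together with the restriction $\varphi$ of the shift map; a minimal subshift here is a subshift that is a Cantor minimal system (i.e. an infinite subshift all of whose orbits are dense). Grigorchuk groups. The binary rooted tree is identified with the set $\{0,1\}^*$ of finite binary strings, rooted at the empty string, where $v,w$ are joined by an edge if $w=vx$ for some $x\in\{0,1\}$. Let $\Omega=\{\mathbf{0},\mathbf{1},\mathbf{2}\}^{\mathbb{N}_+}$ with shift map $\sigma:\Omega\to\Omega$, $(\sigma\omega)(n)=\omega(n+1)$. Let $\varepsilon$ be the non-trivial permutation of $\{0,1\}$ and for $i,j\in\{\mathbf{0},\mathbf{1},\mathbf{2}\}$ let $\varepsilon_{ij}=\varepsilon$ if $i\ne j$ and $\varepsilon_{ij}=\mathrm{id}$ if $i=j$. For $\omega\in\Omega$, $G_\omega$ is the group of automorphisms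 of the tree generated by $a,b_\omega,c_\omega,d_\omega$, where for all $x\in\{0,1\}$, $v\in\{0,1\}^*$: $a(xv)=\varepsilon(x)v$; $b_\omega(0xv)=0\,\varepsilon_{\mathbf{2}\omega(1)}(x)v$, $b_\omega(1v)=1\,b_{\sigma\omega}(v)$; $c_\omega(0xv)=0\,\varepsilon_{\mathbf{1}\omega(1)}(x)v$, $c_\omega(1v)=1\,c_{\sigma\omega}(v)$; $d_\omega(0xv)=0\,\varepsilon_{\mathbf{0}\omega(1)}(x)v$, $d_\omega(1v)=1\,d_{\sigma\omega}(v)$; all four generators fix the empty string, and $b_\omega,c_\omega,d_\omega$ fix the one-letter string $0$. *)

(* Defs.v *)
From HB Require Import structures.
From mathcomp Require Import all_boot all_order all_algebra.
From mathcomp Require Import boolp classical_sets functions topology cantor.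

Set Implicit Arguments.
Unset Strict Implicit.
Unset Printing Implicit Defensive.

Local Open Scope classical_set_scope.
Local Open Scope group_scope.

Record selfbij (T : Type) := SelfBij {
  sb_fun :> T -> T;
  sb_inv : T -> T;
  sb_funK : cancel sb_fun sb_inv;
  sb_invK : cancel sb_inv sb_fun }.

Section SelfBijGroup.
Context {T : Type}.
Implicit Types f g h : selfbij T.

Lemma selfbijP f g : f =1 g -> f = g.
Proof.
case: f g => [f f' fK f'K] [g g' gK g'K] /= fg.
have efg : f = g by apply/funext.
subst g; have e' : f' = g'.
  by apply/funext => x; rewrite -{1}(g'K x) fK.
by subst g'; congr SelfBij; apply: Prop_irrelevance.
Qed.

HB.instance Definition _ := gen_eqMixin (selfbij T).
HB.instance Definition _ := gen_choiceMixin (selfbij T).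

Definition selfbij_one : selfbij T :=
  @SelfBij T id id (fun=> erefl) (fun=> erefl).

(* [f * g] applies [g] first. *)
Definition selfbij_mul f g : selfbij T :=
  SelfBij (can_comp (sb_funK f) (sb_funK g)) (can_comp (sb_invK g) (sb_invK f)).

Definition selfbij_inv f : selfbij T := SelfBij (sb_invK f) (sb_funK f).

Lemma selfbij_mulA : associative selfbij_mul.
Proof. by move=> f g h; apply: selfbijP. Qed.

Lemma selfbij_mul1 : left_id selfbij_one selfbij_mul.
Proof. by move=> f; apply: selfbijP. Qed.

Lemma selfbij_mulr1 : right_id selfbij_one selfbij_mul.
Proof. by move=> f; apply: selfbijP. Qed.

Lemma selfbij_mulV : left_inverse selfbij_one selfbij_inv selfbij_mul.
Proof. by move=> f; apply: selfbijP => x /=; rewrite sb_funK. Qed.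

Lemma selfbij_mulrV : right_inverse selfbij_one selfbij_inv selfbij_mul.
Proof. by move=> f; apply: selfbijP => x /=; rewrite sb_invK. Qed.

HB.instance Definition _ := isGroup.Build (selfbij T)
  selfbij_mulA selfbij_mul1 selfbij_mulr1 selfbij_mulV selfbij_mulrV.

End SelfBijGroup.

Definition generated_subgroup (G : groupType) (S : set G) : set G :=
  smallest [set H : set G | group_closed [in H]] S.

Definition commutator_subgroup (G : groupType) (H : set G) : set G :=
  generated_subgroup [set z | exists x y, [/\ H x, H y & z = [~ x, y]]].

Definition embeds (G1 G2 : groupType) (H : set G1) (K : set G2) : Prop :=
  exists f : G1 -> G2,
    [/\ forall x, H x -> K (f x),
        forall x y, H x -> H y -> f (x * y) = f x * f y &
        forall x y, H x -> H y -> f x = f y -> x = y].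

Definition zexpg (G : groupType) (x : G) (k : int) : G :=
  match k with Posz n => x ^+ n | Negz n => x ^- n.+1 end.

Definition homeomorphic (X Y : topologicalType) : Prop :=
  exists (f : X -> Y) (g : Y -> X),
    [/\ cancel f g, cancel g f, continuous f & continuous g].

Definition homeo (X : topologicalType) (f : selfbij X) : Prop :=
  continuous (sb_fun f) /\ continuous (sb_inv f).

Definition Zorbit (T : Type) (f : selfbij T) (x : T) : set T :=
  [set zexpg f k x | k in [set: int]].

Definition cantor_minimal (X : topologicalType) (f : selfbij X) : Prop :=
  [/\ compact [set: X], homeomorphic X cantor_space, homeo f &
      forall x, dense (Zorbit f x)].

Definition topological_full_group (X : topologicalType) (f : selfbij X) :
    set (selfbij X) :=
  [set g | homeo g /\ exists n : X -> discrete_topology int,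
     continuous n /\ forall x, g x = zexpg f (n x) x].

Definition configuration (A : finType) : Type :=
  {ptws int -> discrete_topology A}.

HB.instance Definition _ (A : finType) := Topological.on (configuration A).

Definition full_shift (A : finType) (x : configuration A) : configuration A :=
  fun i => x (i + 1)%R.

Definition unshift (A : finType) (x : configuration A) : configuration A :=
  fun i => x (i - 1)%R.

Lemma shiftK A : cancel (@full_shift A) (@unshift A).
Proof.
by move=> x; apply/funext => i; rewrite /unshift /full_shift GRing.subrK.
Qed.

Lemma unshiftK A : cancel (@unshift A) (@full_shift A).
Proof.
by move=> x; apply/funext => i; rewrite /unshift /full_shift GRing.addrK.
Qed.

Record subshift (A : finType) := Subshift {
  points :> set (configuration A);
  subshift_closed : closed points;
  subshift_invariant : @full_shift A @` points = points }.

Section SubshiftMap.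
Context {A : finType} (Y : subshift A).

Lemma shift_in (x : configuration A) :
  x \in points Y -> full_shift x \in points Y.
Proof.
by move=> /set_mem Yx; apply/mem_set; rewrite -subshift_invariant; exists x.
Qed.

Lemma unshift_in (x : configuration A) :
  x \in points Y -> unshift x \in points Y.
Proof.
move=> /set_mem; rewrite -{1}subshift_invariant => -[y Yy <-].
by rewrite shiftK; apply/mem_set.
Qed.

Definition restricted_shift (x : set_type Y) : set_type Y :=
  exist _ (full_shift (val x)) (shift_in (valP x)).

Definition restricted_unshift (x : set_type Y) : set_type Y :=
  exist _ (unshift (val x)) (unshift_in (valP x)).

Lemma restricted_shiftK : cancel restricted_shift restricted_unshift.
Proof. by move=> x; apply: val_inj; apply: shiftK. Qed.

Lemma restricted_unshiftK : cancel restricted_unshift restricted_shift.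
Proof. by move=> x; apply: val_inj; apply: unshiftK. Qed.

Definition subshift_map : selfbij (set_type Y) :=
  SelfBij restricted_shiftK restricted_unshiftK.

End SubshiftMap.

Definition minimal_subshift (A : finType) (Y : subshift A) : Prop :=
  cantor_minimal (subshift_map Y).

(* Vertices of the binary rooted tree are words over {0,1}, with
   0 = [false] and 1 = [true]. *)
Definition tree_adj (v w : seq bool) : Prop :=
  (exists x, w = rcons v x) \/ (exists x, v = rcons w x).

Definition tree_automorphism (f : selfbij (seq bool)) : Prop :=
  f [::] = [::] /\ forall v w, tree_adj (f v) (f w) <-> tree_adj v w.

(* Sequences are indexed from 0: the letter omega(n+1) is [omega n]. *)
Definition Omega : Type := nat -> 'I_3.

Definition Omega_shift (omega : Omega) : Omega := fun n => omega n.+1.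

Definition eps (i j : 'I_3) : bool -> bool := if i != j then negb else id.

Definition digit0 : 'I_3 := @Ordinal 3 0 isT.
Definition digit1 : 'I_3 := @Ordinal 3 1 isT.
Definition digit2 : 'I_3 := @Ordinal 3 2 isT.

Definition grig_a_fun (v : seq bool) : seq bool :=
  if v is x :: v' then ~~ x :: v' else [::].

(* The common pattern of b, c, d, which correspond to i = 2, 1, 0. *)
Fixpoint grig_fun (i : 'I_3) (omega : Omega) (v : seq bool) : seq bool :=
  match v with
  | [::] => [::]
  | [:: false] => [:: false]
  | false :: x :: v' => false :: eps i (omega 0) x :: v'
  | true :: v' => true :: grig_fun i (Omega_shift omega) v'
  end.

Lemma grig_a_funK : involutive grig_a_fun.
Proof. by case=> //= x v; rewrite negbK. Qed.

Lemma epsK i j : involutive (eps i j).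
Proof. by rewrite /eps; case: ifP => _ x //; rewrite negbK. Qed.

Lemma grig_funK i omega : involutive (grig_fun i omega).
Proof.
move=> v; elim: v omega => [|[] v IHv] omega //=; first by rewrite IHv.
by case: v {IHv} => [|x v] //=; rewrite epsK.
Qed.

Definition grig_a : selfbij (seq bool) := SelfBij grig_a_funK grig_a_funK.

Definition grig_b (omega : Omega) : selfbij (seq bool) :=
  SelfBij (grig_funK digit2 omega) (grig_funK digit2 omega).

Definition grig_c (omega : Omega) : selfbij (seq bool) :=
  SelfBij (grig_funK digit1 omega) (grig_funK digit1 omega).

Definition grig_d (omega : Omega) : selfbij (seq bool) :=
  SelfBij (grig_funK digit0 omega) (grig_funK digit0 omega).

Definition grigorchuk_group (omega : Omega) : set (selfbij (seq bool)) :=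
  generated_subgroup [set grig_a; grig_b omega; grig_c omega; grig_d omega].

(* The generators are tree automorphisms, so generating a subgroup inside all
   bijections of the vertex set is the same as inside the automorphism group
   of the tree. *)
Lemma tree_automorphism_involution (f : seq bool -> seq bool)
    (fK : involutive f) :
    f [::] = [::] ->
    (forall v x, exists y, f (rcons v x) = rcons (f v) y) ->
  tree_automorphism (SelfBij fK fK).
Proof.
move=> f0 fS; split=> //= v w.
have fadj u u' : tree_adj u u' -> tree_adj (f u) (f u').
  by case=> -[x ->]; [left; case: (fS u x)|right; case: (fS u' x)] => y ->;
    exists y.
by split=> [/fadj|/fadj //]; rewrite !fK.
Qed.

Lemma grig_a_tree : tree_automorphism grig_a.
Proof.
apply: tree_automorphism_involution => [//|[|z v] x /=].
  by exists (~~ x).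
by exists x.
Qed.

Lemma grig_fun_tree i omega :
  tree_automorphism (SelfBij (grig_funK i omega) (grig_funK i omega)).
Proof.
apply: tree_automorphism_involution => [//|v x].
elim: v omega => [|[] v IHv] omega /=.
- by case: x; [exists true|exists false].
- by have [y ->] := IHv (Omega_shift omega); exists y.
- case: v {IHv} => [|z v] /=; first by exists (eps i (omega 0) x).
  by exists x.
Qed.

Lemma tree_automorphism_group_closed :
  group_closed [in [set f | tree_automorphism f]].
Proof.
split; first by apply: mem_set.
move=> f g /set_mem [f0 fP] /set_mem [g0 gP]; apply/mem_set.
have gV v : g (sb_inv g v) = v by exact: sb_invK.
split=> [|v w] /=; first by rewrite -{1}g0 sb_funK f0.
by rewrite fP -gP !gV.
Qed.

Lemma grigorchuk_group_tree omega :
  grigorchuk_group omega `<=` [set f | tree_automorphism f].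
Proof.
apply: smallest_sub; first exact: tree_automorphism_group_closed.
by move=> f [[[->|->]|->]|->]; [exact: grig_a_tree|exact: grig_fun_tree..].
Qed.

(* Main.v *)
Require Import Defs.
From HB Require Import structures.
From mathcomp Require Import all_boot all_order all_algebra.
From mathcomp Require Import boolp classical_sets cardinality functions.
From mathcomp Require Import topology cantor reals Rstruct zify.

(** Each generator of G_omega acts on the orbit of the boundary point 111...
    of the binary tree by crossing edges of a half-line. Number the vertices
    of this line 0, 1, 2, ...; the vertex q is then a Gray code of q, lowest
    bit first, and the edge between q - 1 and q depends only on the 2-adic
    valuation k of q. For k = 0 the edge is crossed by a, and for k >= 1 by
    those of b, c, d whose index (2, 1 and 0 respectively) differs from
    omega (k - 1) ([tree_gen_gray]). A word in the generators is trivial in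
    G_omega if and only if it fixes all vertices of the half-line, and it
    suffices that it fixes all vertices far from the end, because every tree
    vertex is a prefix of the codes of arbitrarily large numbers
    ([tree_word_trivial_far]).

    The labels of the line form a Toeplitz sequence n |-> L (v_2 n). The
    subshift Y consists of the bi-infinite sequences whose windows all occur
    in it. When L k <> L (k + 1) for all k, this Y is a Cantor minimal
    system without periodic points ([toeplitz_minimal],
    [toeplitz_aperiodic]). The letters record the parity of k besides omega,
    so that the condition holds even for an eventually constant omega, whose
    bare labels only give periodic points. A point of Y shows locally which
    edges surround its origin. Crossing them is therefore an element of the
    topological full group, and a word in these elements translates a point
    that looks like the line near the position p by as much as the word
    moves p on the line ([tracks]). By aperiodicity, such a word is trivial
    on Y if and only if it is trivial far from the end of the line, that is,
    if and only if it is trivial in G_omega ([word_trivial_iff]).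

    To land in the commutator subgroup, the line is doubled: L has one more
    letter in front, every vertex q becomes the two positions 2q and 2q + 1,
    and the generators act on both copies. The involution [swap] exchanges
    the copies. The part [gen_even] of a generator that moves only the even
    copy is an involution, so its commutator with [swap] is the product of
    [gen_even] and its conjugate by [swap], which is the generator on both
    copies ([shift_gen]). *)

Set Implicit Arguments.
Unset Strict Implicit.
Unset Printing Implicit Defensive.

Local Open Scope classical_set_scope.

(** * Cylinders in a subshift *)

Section Cylinders.
Context {A : finType}.
Implicit Types x y z : configuration A.

Definition agree (R : nat) x y := forall j : int, (`|j| <= R)%N -> x j = y j.

Lemma agree_le R R' x y : (R' <= R)%N -> agree R x y -> agree R' x y.
Proof. by move=> RR' xy j jR; apply: xy; apply: leq_trans RR'. Qed.

Lemma nbhs_agree R y : nbhs y [set z | agree R y z].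
Proof.
have nbhs_coord (j : int) : nbhs y [set z | y j = z j].
  have := @proj_continuous int (fun=> discrete_topology A) j y [set y j].
  move=> /(_ (discrete_set1 _)); apply: (@filterS _ (nbhs y)) => z /= zj.
  by symmetry.
elim: R => [|R IHR].
  apply: filterS (nbhs_coord 0%R) => z /= z0 j; rewrite leqn0 absz_eq0.
  by move=> /eqP ->.
have nR := nbhs_coord (- R.+1%:Z)%R.
apply: filterS (filterI IHR (filterI (nbhs_coord R.+1) nR)).
move=> z /= [zR [zp zn]] j jR.
have [jR'|] := leqP `|j| R; first exact: zR.
move=> Rj; have /orP[/eqP->|/eqP->] : (j == R.+1) || (j == - R.+1%:Z)%R by lia.
- exact: zp.
- exact: zn.
Qed.

Lemma nbhs_agreeP y (U : set (configuration A)) :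
  nbhs y U -> exists R, forall z, agree R y z -> U z.
Proof.
(* The filter of cylinders around y converges to y in every coordinate, hence in
   the product topology. *)
pose F : set_system (configuration A) :=
  filter_from [set: nat] (fun R => [set z | agree R y z]).
have FF : Filter F.
  apply: filter_from_filter; first by exists 0.
  move=> i j _ _; exists (maxn i j) => // z yz; split; apply: agree_le yz.
    exact: leq_maxl.
  exact: leq_maxr.
suff Fy : F --> y by move=> /Fy [R _ RU]; exists R => z; apply: RU.
apply/cvg_sup => j V [W [[W' oW' WE] Wy] WV].
exists `|j|%N => // z yz; apply: WV; rewrite -WE /=.
by rewrite -(yz j (leqnn _)); move: Wy; rewrite -WE.
Qed.

Context {Y : subshift A}.
Implicit Types u v : set_type Y.

(** Turns every topological question about a subshift into one about finite
    windows. *)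
Lemma nbhs_subshiftP u (U : set (set_type Y)) :
  nbhs u U <-> exists R, forall v, agree R (val u) (val v) -> U v.
Proof.
split.
  move=> [_ [[W oW <-] Wu] WU].
  have /nbhs_agreeP[R RW] : nbhs (val u) W by apply: open_nbhs_nbhs.
  by exists R => v uv; apply: WU; apply: RW.
move=> [R RU].
have := @initial_continuous _ _ (val : set_type Y -> configuration A) u.
move=> /(_ _ (nbhs_agree R (val u))).
by apply: (@filterS _ (nbhs u)) => v; apply: RU.
Qed.

Lemma continuous_local_code (F : set_type Y -> set_type Y) :
  (forall i, exists R, forall u v, agree R (val u) (val v) ->
     val (F u) i = val (F v) i) -> continuous F.
Proof.
move=> Floc u U /nbhs_subshiftP[R RU].
suff [R' FR'] : exists R', forall v, agree R' (val u) (val v) ->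
    agree R (val (F u)) (val (F v)).
  by apply/nbhs_subshiftP; exists R' => v uv; apply: RU; apply: FR'.
elim: R {RU} => [|R [R1 IH]].
  have [R0 R0P] := Floc 0%R; exists R0 => v uv j.
  by rewrite leqn0 absz_eq0 => /eqP->; apply: R0P.
have [Rp RpP] := Floc R.+1; have [Rn RnP] := Floc (- R.+1%:Z)%R.
exists (maxn R1 (maxn Rp Rn)) => v uv j jR.
have [jR'|] := leqP `|j| R.
  by apply: IH => //; apply: agree_le uv; lia.
move=> Rj; have /orP[/eqP->|/eqP->] : (j == R.+1) || (j == - R.+1%:Z)%R by lia.
- by apply: RpP; apply: agree_le uv; lia.
- by apply: RnP; apply: agree_le uv; lia.
Qed.

Lemma continuous_local_discrete (m : set_type Y -> int) R :
  (forall u v, agree R (val u) (val v) -> m u = m v) ->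
  continuous (m : set_type Y -> discrete_topology int).
Proof.
move=> mloc u V /nbhs_singleton Vu.
suff : nbhs u [set v | V (m v)] by [].
by apply/nbhs_subshiftP; exists R => v uv /=; rewrite -(mloc u v).
Qed.

End Cylinders.

(** * Translations and the topology of a subshift *)

Section Translation.
Context {A : finType} {Y : subshift A}.
Implicit Types u v : set_type Y.

Definition translate (k : int) u : set_type Y := zexpg (subshift_map Y) k u.

Lemma val_translate k u i : val (translate k u) i = val u (i + k)%R.
Proof.
have posE n v j : val ((subshift_map Y ^+ n)%g v) j = val v (j + n%:Z)%R.
  elim: n j => [|n IHn] j; first by rewrite expg0 GRing.addr0.
  rewrite expgS [LHS]/= /full_shift IHn; congr (val v _); lia.
case: k => n; first exact: posE.
rewrite -[in RHS](sb_invK (subshift_map Y ^+ n.+1)%g u) posE.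
by congr (val _ _); rewrite NegzE; lia.
Qed.

Lemma translate0 u : translate 0 u = u.
Proof. by []. Qed.

Lemma translateD j k u : translate j (translate k u) = translate (j + k) u.
Proof.
apply: val_inj; apply/funext => i; rewrite !val_translate.
by congr (val u _); lia.
Qed.

Lemma homeo_subshift_map : homeo (subshift_map Y).
Proof.
split; apply: continuous_local_code => i; exists (`|i| + 1)%N => u v uv;
  by apply: uv; lia.
Qed.

Lemma compact_subshift : compact [set: set_type Y].
Proof.
have cY : compact (points Y : set (configuration A)).
  apply: (@subclosed_compact _ _ [set: configuration A]) => //.
    exact: subshift_closed.
  have := @tychonoff int (fun=> discrete_topology A) (fun=> setT).
  rewrite (_ : [set f | _] = setT); last by apply/seteqP; split.
  by apply=> _; apply: finite_compact; apply: (@finite_finset A).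
move=> F FF _.
pose G : set_system (configuration A) := fmap (val : set_type Y -> _) F.
have GY : G (points Y).
  by apply: (@filterS _ F) filterT => u _; apply: set_mem; exact: (valP u).
have [y [Yy yG]] := cY G (fmap_proper_filter _ FF) GY.
pose u : set_type Y := exist _ y (mem_set Yy).
exists u; split=> // B C FB /nbhs_subshiftP[R RC].
have GB : G (val @` B) by apply: (@filterS _ F) FB => v Bv; exists v.
have [_ [[v Bv <-] yv]] := yG _ _ GB (nbhs_agree R y).
by exists v; split=> //; apply: RC.
Qed.

Lemma hausdorff_subshift : hausdorff_space (set_type Y).
Proof.
move=> u v uv; apply: val_inj; apply/funext => i.
have nu (w : set_type Y) :
    nbhs w [set z : set_type Y | agree `|i| (val w) (val z)].
  by apply/nbhs_subshiftP; exists `|i|%N.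
by have [z [uz vz]] := uv _ _ (nu u) (nu v); rewrite uz ?vz.
Qed.

Lemma zero_dimensional_subshift : zero_dimensional (set_type Y).
Proof.
move=> u v uv.
have [i ui] : exists i, val u i <> val v i.
  apply: contrapT => uvE; move/eqP: uv; apply; apply: val_inj.
  by apply/funext => i; apply: contrapT => ui; apply: uvE; exists i.
have openE (P : set (set_type Y)) :
    (forall w z, agree `|i| (val w) (val z) -> P w -> P z) -> open P.
  rewrite openE => PP w Pw; apply/nbhs_subshiftP; exists `|i|%N => z wz.
  exact: PP Pw.
exists [set w | val w i = val u i]; split=> //; last exact: nesym.
split; first by apply: openE => w z wz /= <-; rewrite wz.
rewrite -openC; apply: openE => w z wz /= wi zi; apply: wi.
by rewrite wz.
Qed.

(** Brouwer's characterization of the Cantor set. The pseudometric it asks for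
    is that of a countable product of discrete spaces. *)
Lemma subshift_cantor (u0 : set_type Y) :
  perfect_set [set: set_type Y] -> homeomorphic (set_type Y) cantor_space.
Proof.
move=> pY.
pose R := Rdefinitions.R.
pose T1 : pseudoMetricType R :=
  set_type (points Y : set {ptws int -> discrete_topology A}).
pose T : pseudoPMetricType R := HB.pack T1 (isPointed.Build T1 u0).
have cT : cantor_like T.
  split=> //; [exact: compact_subshift|exact: hausdorff_subshift|].
  exact: zero_dimensional_subshift.
have [f [fc fcl]] := homeomorphism_cantor_like cT.
have fK : cancel f^-1%FUN f by move=> x; apply: invK; rewrite inE.
have gK : cancel f f^-1%FUN by move=> x; apply: funK; rewrite inE.
exists (f^-1%FUN : set_type Y -> cantor_space).
exists (f : cantor_space -> set_type Y).
split=> //; apply/continuous_closedP => B /fcl.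
rewrite (_ : f @` B = f^-1%FUN @^-1` B) //.
apply/seteqP; split=> [_ [x Bx <-]|x Bx] /=; first by rewrite gK.
by exists (f^-1%FUN x).
Qed.

End Translation.

(** * The 2-adic Toeplitz subshift of a sequence of letters *)

Lemma logn_lt p k m : prime p -> (0 < m)%N -> (m < p ^ k)%N -> (logn p m < k)%N.
Proof.
move=> pr_p m0; apply: contraTltn => km; rewrite -leqNgt.
apply: dvdn_leq => //; apply: dvdn_trans (dvdn_exp2l p km) _.
exact: pfactor_dvdnn.
Qed.

Lemma logn_addz p k (a b : int) : prime p -> (p ^ k %| `|a|)%N ->
  (b != 0)%R -> (logn p `|b| < k)%N -> logn p `|(a + b)%R|%N = logn p `|b|.
Proof.
move=> pr_p ka b0 bk.
have ab j : (j <= k)%N -> (p ^ j %| `|(a + b)%R|%N)%N = (p ^ j %| `|b|)%N.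
  move=> jk; have ja := dvdn_trans (dvdn_exp2l p jk) ka.
  have jaz : (Posz (p ^ j)%N %| a)%Z by [].
  by rewrite -[LHS]/(Posz (p ^ j)%N %| (a + b)%R)%Z GRing.rpredDl.
have ab0 : (0 < `|(a + b)%R|%N)%N.
  rewrite lt0n; apply/eqP => ab0; have := ab k (leqnn k).
  rewrite ab0 dvdn0 pfactor_dvdn ?lt0n ?absz_eq0 // => /esym.
  by rewrite leqNgt bk.
have b0' : (0 < `|b|)%N by rewrite absz_gt0.
apply/eqP; rewrite eqn_leq leqNgt -!pfactor_dvdn //.
rewrite ab // ab ?pfactor_dvdnn 1?ltnW //.
by rewrite pfactor_dvdn // ltnn.
Qed.

Section Toeplitz.
Context {A : finType} (L : nat -> A) (L_neq : forall k, L k <> L k.+1).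

(** The true valuation of 0 is infinite; only nonzero arguments matter. *)
Definition ruler (n : int) : A := L (logn 2 `|n|).

(** The bound [R < p] keeps the window within the positive integers. *)
Definition looks_like (R : nat) (y : configuration A) (p : nat) : Prop :=
  (R < p)%N /\ forall j : int, (`|j| <= R)%N -> y j = ruler (p%:Z + j)%R.

Lemma looks_like_le R R' y p :
  (R' <= R)%N -> looks_like R y p -> looks_like R' y p.
Proof.
move=> RR' [Rp yp]; split=> [|j jR]; [exact: leq_ltn_trans RR' Rp|].
by apply: yp; exact: leq_trans RR'.
Qed.

Lemma looks_like_shift R y z p q (d : int) :
  (forall i, z i = y (i + d)%R) -> Posz q = (p%:Z + d)%R ->
  looks_like (R + `|d|) y p -> looks_like R z q.
Proof.
move=> zE qE [Rp yp]; split=> [|j jR]; first by lia.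
by rewrite zE yp; [congr ruler; lia|lia].
Qed.

Definition toeplitz : set (configuration A) :=
  [set y | forall R, exists p, looks_like R y p].

Lemma toeplitz_shift (d : int) y z :
  (forall i, z i = y (i + d)%R) -> toeplitz y -> toeplitz z.
Proof.
move=> zE yT R; have [p yp] := yT (R + `|d|)%N.
exists `|(p%:Z + d)%R|%N; apply: (looks_like_shift zE _ yp).
by case: yp => Rp _; lia.
Qed.

Lemma toeplitz_closed : closed toeplitz.
Proof.
move=> y yT R; have [z [zT yz]] := yT _ (nbhs_agree R y).
have [p [Rp zp]] := zT R; exists p; split=> // j jR.
by rewrite yz ?zp.
Qed.

Lemma toeplitz_invariant : @full_shift A @` toeplitz = toeplitz.
Proof.
apply/seteqP; split=> [_ [y yT <-]|y yT]; first exact: (@toeplitz_shift 1 y).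
exists (unshift y); last exact: unshiftK.
by apply: (@toeplitz_shift (-1) y).
Qed.

Definition toeplitz_subshift : subshift A :=
  Subshift toeplitz_closed toeplitz_invariant.

Local Notation Y := toeplitz_subshift.
Implicit Types u v : set_type Y.

Lemma toeplitzP u R : exists p, looks_like R (val u) p.
Proof. by have /set_mem := valP u; apply. Qed.

Lemma looks_like_translate R d u p q : Posz q = (p%:Z + d)%R ->
  looks_like (R + `|d|) (val u) p -> looks_like R (val (translate d u)) q.
Proof. by apply: looks_like_shift => i; rewrite val_translate. Qed.

Lemma ruler_periodic n (a b : int) : (2 ^ n %| `|a|)%N -> (b != 0)%R ->
  (`|b| < 2 ^ n)%N -> ruler (a + b)%R = ruler b.
Proof.
move=> na b0 bn; rewrite /ruler (logn_addz _ na b0) //.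
by apply: logn_lt => //; rewrite absz_gt0.
Qed.

(** This is minimality. Away from the multiples of 2 ^ n the ruler sequence is
    2 ^ n periodic, so for large n a given window of it reappears after every
    multiple of 2 ^ n, and long windows of any point contain such multiples. *)
Lemma toeplitz_recurrence u R p : (R < p)%N ->
  exists i, looks_like R (val (translate i u)) p.
Proof.
move=> Rp; pose n := (p + R)%N.
have pn : (p + R < 2 ^ n)%N := ltn_expl _ (ltnSn 1).
have [P [nP uP]] := toeplitzP u (2 ^ n).
(* The last multiple of 2 ^ n up to P. *)
pose m := (P %/ 2 ^ n * 2 ^ n)%N.
have mP : (m <= P)%N := leq_trunc_div _ _.
have Pm : (P - m < 2 ^ n)%N.
  by rewrite {1}(divn_eq P (2 ^ n)) addKn ltn_mod expn_gt0.
exists (m%:Z + p%:Z - P%:Z)%R; split=> // j jR.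
rewrite val_translate uP; last by lia.
rewrite -(@ruler_periodic n m (p%:Z + j)); first by congr ruler; lia.
- exact: dvdn_mull.
- by lia.
- by lia.
Qed.

(** If d has valuation k, there are positions p of valuation k such that p + d
    has valuation k + 1; a period d would give L k = L (k + 1). *)
Lemma toeplitz_aperiodic u d : translate d u = u -> d = 0%R.
Proof.
move=> du; apply: contrapT => /eqP d0.
(* m will be p + d: an odd multiple of 2 ^ (k + 1), large enough for p > |d|. *)
pose k := logn 2 `|d|; pose m := (2 ^ k.+1 * (`|d|.*2).+1)%N.
have k0 : (0 < 2 ^ k.+1)%N by rewrite expn_gt0.
have mdvd : (2 ^ k.+1 %| m)%N by apply: dvdn_mulr.
have dm : (2 * `|d| < m)%N.
  by rewrite /m -mul2n; apply: leq_pmull.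
pose p := `|(m%:Z - d)%R|%N.
have pE : Posz p = (m%:Z - d)%R by rewrite /p; lia.
have [i [_ up]] := @toeplitz_recurrence u `|d| p ltac:(lia).
have logm : logn 2 m = k.+1.
  rewrite lognM // pfactorK // logn_coprime ?addn0 //.
  by rewrite coprime2n /= odd_double.
have logp : logn 2 p = k.
  have := @logn_addz 2 k.+1 m (- d)%R; rewrite abszN; apply=> //.
  by rewrite GRing.oppr_eq0.
have : val (translate i u) 0%R = val (translate i u) d.
  have {1}-> : translate i u = translate d (translate i u).
    by rewrite translateD GRing.addrC -translateD du.
  by rewrite val_translate GRing.add0r.
rewrite !up // ?absz0 // pE GRing.addr0 GRing.subrK -pE /ruler.
by rewrite absz_nat logp absz_nat logm; apply: L_neq.
Qed.

(** A point of the subshift is the ruler sequence read around the 2-adic integer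
    1/3, where no position has infinite valuation: as 3 is odd, i + 1/3 and
    3 i + 1 have the same valuation. *)
Lemma toeplitz_nonempty : [set: set_type Y] !=set0.
Proof.
suff yT : toeplitz (fun i => ruler (3 * i + 1)%R).
  by exists (exist (fun y => y \in points Y) _ (mem_set yT)).
move=> R; pose n := (3 * R + 2)%N.
have Rn : (3 * R + 1 < 2 ^ n)%N.
  by apply: leq_trans (ltn_expl n (ltnSn 1)); rewrite /n; lia.
(* p approximates 1/3 modulo 2 * 4 ^ n. *)
have [p pE] : exists p, (3 * p = 2 * 4 ^ n + 1)%N.
  elim: n {Rn} => [|n [p pE]]; first by exists 1.
  by exists (4 * p - 1)%N; rewrite expnS; lia.
have n4 : (2 ^ n <= 4 ^ n)%N by case: (n) => // m; rewrite leq_exp2r.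
exists p; split=> [|j jR]; first by lia.
rewrite -(@ruler_periodic n (2 * 4 ^ n)%N (3 * j + 1)%R); last by lia.
- have -> : ((2 * 4 ^ n)%N%:Z + (3 * j + 1) = 3 * (p%:Z + j))%R by lia.
  by rewrite /ruler abszM logn_Gauss.
- by rewrite absz_nat (expnMn 2 2) mulnA; apply: dvdn_mull.
- by lia.
Qed.

Lemma toeplitz_dense u : dense (Zorbit (subshift_map Y) u).
Proof.
move=> O [v Ov] oO; have : nbhs v O by apply: open_nbhs_nbhs.
move=> /nbhs_subshiftP[R RO]; have [p [Rp vp]] := toeplitzP v R.
have [i [_ ui]] := toeplitz_recurrence u Rp.
exists (translate i u); split; last by exists i.
by apply: RO => j jR; rewrite ui ?vp.
Qed.

(** An isolated point u would be its own translate by K = 2 ^ (p + R): a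
    cylinder containing only u is given by a window that occurs in the ruler
    sequence at two positions which differ by K. *)
Lemma toeplitz_perfect : perfect_set [set: set_type Y].
Proof.
apply/perfectTP => u ou.
have /nbhs_subshiftP[R Ru] : nbhs u [set u] by apply: open_nbhs_nbhs.
have [p up] := toeplitzP u R; have [Rp _] := up.
pose K := (2 ^ (p + R))%N.
have Kp : (p + R < K)%N := ltn_expl _ (ltnSn 1).
have uE v m q : q = (p + m * K)%N -> looks_like R (val v) q -> v = u.
  move=> -> [_ vq]; apply: Ru => j jR; rewrite vq //.
  rewrite (_ : _ + _ = (m * K)%N%:Z + (p%:Z + j))%R; last by lia.
  rewrite (@ruler_periodic (p + R)) ?up.2 //; [exact: dvdn_mull|lia|].
  by rewrite -/K; lia.
(* Two periods are added to p to leave room for a window of radius R + K. *)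
have [i wp] := @toeplitz_recurrence u (R + K) (p + 2 * K) ltac:(lia).
have wu : translate i u = u.
  by apply: (uE _ 2 _ erefl); apply: looks_like_le wp; lia.
have : translate K (translate i u) = u.
  apply: (uE _ 3 _ erefl).
  by apply: (@looks_like_translate _ K _ (p + 2 * K)); [lia|rewrite absz_nat].
by rewrite wu => /toeplitz_aperiodic; lia.
Qed.

Theorem toeplitz_minimal : minimal_subshift Y.
Proof.
have [u0 _] := toeplitz_nonempty.
split; [exact: compact_subshift| |exact: homeo_subshift_map|].
  exact: subshift_cantor toeplitz_perfect.
exact: toeplitz_dense.
Qed.

End Toeplitz.

(** * Groups generated by involutions *)

Section Generation.
Local Open Scope group_scope.

Lemma generated_subgroup_closed (G : groupType) (S : set G) :
  group_closed [in generated_subgroup S].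
Proof.
split=> [|x y /set_mem xS /set_mem yS]; apply/mem_set => H [Hgrp SH].
  by have [/set_mem] := Hgrp.
have [_ HB] := Hgrp; apply: set_mem; apply: HB; apply: mem_set.
  exact: xS.
exact: yS.
Qed.

Lemma prod_in_group (G : groupType) (K : set G) (I : Type) (f : I -> G) w :
  group_closed [in K] -> (forall i, K (f i)) -> K (\prod_(i <- w) f i).
Proof.
move=> Kgrp Kf; elim: w => [|i w IHw].
  by rewrite big_nil; have [/set_mem] := Kgrp.
rewrite big_cons; apply: set_mem.
by apply: (group_closedM Kgrp); apply: mem_set.
Qed.

Lemma prod_rev_involutions (G : groupType) (I : Type) (e : I -> G) w :
  (forall i, e i * e i = 1) ->
  \prod_(i <- rev w) e i = (\prod_(i <- w) e i)^-1.
Proof.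
move=> e2; elim: w => [|i w IHw]; first by rewrite !big_nil invg1.
rewrite rev_cons -cats1 big_cat big_seq1 big_cons IHw invgM.
by congr (_ * _); rewrite -[LHS]mulg1 -(mulgV (e i)) mulgA e2 mul1g.
Qed.

Lemma generated_by_involutions (G : groupType) (I : Type) (e : I -> G) :
  (forall i, e i * e i = 1) ->
  forall x, generated_subgroup (range e) x -> exists w, x = \prod_(i <- w) e i.
Proof.
move=> e2; apply: smallest_sub; last first.
  by move=> _ [i _ <-]; exists [:: i]; rewrite big_seq1.
split=> [|_ _ /set_mem[w ->] /set_mem[w' ->]]; apply/mem_set.
  by exists [::]; rewrite big_nil.
by exists (w ++ rev w'); rewrite big_cat prod_rev_involutions.
Qed.

(** Sending a word in the generators to the same word elsewhere is well
    defined and injective as soon as the same words are trivial. *)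
Lemma embeds_by_words (G H : groupType) (I : Type) (e : I -> G) (f : I -> H)
    (K : set H) :
  (forall i, e i * e i = 1) -> (forall i, f i * f i = 1) ->
  group_closed [in K] -> (forall i, K (f i)) ->
  (forall w, \prod_(i <- w) e i = 1 <-> \prod_(i <- w) f i = 1) ->
  embeds (generated_subgroup (range e)) K.
Proof.
move=> e2 f2 Kgrp Kf ef.
have ef2 w w' : \prod_(i <- w) e i = \prod_(i <- w') e i <->
    \prod_(i <- w) f i = \prod_(i <- w') f i.
  have := ef (w ++ rev w').
  rewrite !big_cat !prod_rev_involutions // => -[ef1 fe1].
  split=> E; apply: divg1_eq; [apply: ef1|apply: fe1]; rewrite E;
    exact: mulgV.
have /choice[wd wdP] x : exists w,
    generated_subgroup (range e) x -> x = \prod_(i <- w) e i.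
  have [/(generated_by_involutions e2)[w xw]|xe] :=
    pselect (generated_subgroup (range e) x); [by exists w|by exists [::]].
exists (fun x => \prod_(i <- wd x) f i); split=> [x _|x y xe ye|x y xe ye].
- exact: prod_in_group.
- rewrite -big_cat; apply/ef2; rewrite big_cat -!wdP //.
  have eM := group_closedM (generated_subgroup_closed (range e)).
  exact: set_mem (eM _ _ (mem_set xe) (mem_set ye)).
- by move/ef2; rewrite -!wdP.
Qed.

End Generation.

(** * The action of a Grigorchuk group on a half-line *)

Section HalfLine.
Implicit Types (omega : Omega) (s : option 'I_3) (n q : nat).

(** [None] stands for a, and [Some i] for d, c, b when i is 0, 1, 2. *)
Definition tree_gen omega s : selfbij (seq bool) :=
  if s is Some i then SelfBij (grig_funK i omega) (grig_funK i omega)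
  else grig_a.

Lemma grigorchuk_groupE omega :
  grigorchuk_group omega = generated_subgroup (range (tree_gen omega)).
Proof.
congr generated_subgroup; apply/seteqP; split.
  by move=> _ [[[->|->]|->]|->]; [exists None|exists (Some digit2)
    |exists (Some digit1)|exists (Some digit0)].
move=> _ [[i|] _ <-]; last by do 3 left.
case: i => -[|[|[|//]]] i3; [right|left; right|left; left; right].
- by rewrite (_ : Ordinal i3 = digit0) //; apply: val_inj.
- by rewrite (_ : Ordinal i3 = digit1) //; apply: val_inj.
- by rewrite (_ : Ordinal i3 = digit2) //; apply: val_inj.
Qed.

Lemma tree_gen_involution omega s : (tree_gen omega s * tree_gen omega s = 1)%g.
Proof.
by apply: selfbijP => v; case: s => [i|]; [exact: grig_funK|exact: grig_a_funK].
Qed.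

(** The edge between q and q + 1 belongs to a when q is even, and has the label
    omega (v_2 (q + 1) - 1) when q is odd. There is no edge on the left of 0. *)
Definition line_gen omega s q : nat :=
  match s with
  | None => if odd q then q.-1 else q.+1
  | Some i =>
      if odd q then (if i != omega (logn 2 q.+1).-1 then q.+1 else q)
      else if (0 < q) && (i != omega (logn 2 q).-1) then q.-1 else q
  end.

(** The letter 1 on q = 0 and 3 modulo 4, and the letter 0 on q = 1 and 2: the
    edges from 4j + 1 to 4j + 2, which collapse to an edge of a when the first
    letter is dropped, are those where b, c, d act after a first letter 0. *)
Definition gray_bit q : bool := odd q (+) ~~ odd q./2.

Fixpoint gray n q : seq bool :=
  if n is n'.+1 then gray_bit q :: gray n' q./2 else [::].

Lemma grayS n q : gray n.+1 q = gray_bit q :: gray n q./2.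
Proof. by []. Qed.

Lemma logn2_double q : (0 < q)%N -> logn 2 q.*2 = (logn 2 q).+1.
Proof. by move=> q0; rewrite -mul2n lognM // logn_prime. Qed.

Lemma logn2_odd q : odd q -> logn 2 q = 0%N.
Proof. by move=> q_odd; rewrite logn_coprime // coprime2n. Qed.

Lemma grig_fun_false i omega v : grig_fun i omega (false :: v) =
  false :: (if i != omega 0 then grig_a_fun v else v).
Proof. by case: v => [|x v] /=; rewrite /eps; case: ifP. Qed.

Lemma grig_a_gray omega n q :
  grig_a_fun (gray n q) = gray n (line_gen omega None q).
Proof.
case: n => //= n; set l := if odd q then _ else _.
have lq : l./2 = q./2 by rewrite /l; case: ifP; lia.
have lo : odd l = ~~ odd q by rewrite /l; case: ifP; lia.
by rewrite /gray_bit lq lo addNb.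
Qed.

(** Halving the vertices of the line removes the first letter of their Gray
    codes, so this is the recursion that defines b, c and d. *)
Lemma line_gen_half i omega q (l := line_gen omega (Some i) q) :
  gray_bit l = gray_bit q /\
  l./2 = if gray_bit q then line_gen (Omega_shift omega) (Some i) q./2
         else if i != omega 0 then line_gen omega None q./2 else q./2.
Proof.
have logE r : (0 < r)%N -> (logn 2 r.*2).-1 = logn 2 r.
  by move=> r0; rewrite logn2_double.
have shiftE r : (0 < r)%N -> ~~ odd r ->
    omega (logn 2 r) = Omega_shift omega (logn 2 r).-1.
  move=> r0 r_even; have rE : r = r./2.*2 by lia.
  by rewrite rE logn2_double //; lia.
have := odd_double_half q; have := odd_double_half q./2.
rewrite {}/l /gray_bit /line_gen; set j := q./2./2.
case: (odd q); case: (odd q./2) => /= jE qE; rewrite ?add0n ?add1n in jE qE.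
- have -> : q.+1 = (q./2.+1).*2 by lia.
  rewrite logE // shiftE //; last by lia.
  by case: ifP => _; split; lia.
- have -> : q.+1 = (j.*2.+1).*2 by lia.
  rewrite logE // logn2_odd /=; last by lia.
  by case: ifP => _; split; lia.
- have q0 : (0 < q)%N by lia.
  have -> : logn 2 q = logn 2 (j.*2.+1).*2 by congr (logn 2 _); lia.
  rewrite q0 logE // logn2_odd /=; last by lia.
  by case: ifP => _; split; lia.
- case: (posnP q) => [q0|q0]; first by rewrite q0.
  have h0 : (0 < q./2)%N by lia.
  rewrite h0 (_ : logn 2 q = logn 2 q./2.*2); last by congr (logn 2 _); lia.
  rewrite logE // shiftE //; last by lia.
  by case: ifP => _; split; lia.
Qed.

Lemma grig_fun_gray i omega n q :
  grig_fun i omega (gray n q) = gray n (line_gen omega (Some i) q).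
Proof.
elim: n omega q => // n IHn omega q.
have [bitE halfE] := line_gen_half i omega q.
rewrite !grayS bitE halfE.
case: (gray_bit q); first by rewrite /= IHn.
by rewrite grig_fun_false (grig_a_gray omega); case: ifP.
Qed.

Lemma tree_gen_gray omega s n q :
  tree_gen omega s (gray n q) = gray n (line_gen omega s q).
Proof. by case: s => [i|]; [apply: grig_fun_gray|apply: grig_a_gray]. Qed.

Lemma gray_inj n q q' :
  (q < 2 ^ n)%N -> (q' < 2 ^ n)%N -> gray n q = gray n q' -> q = q'.
Proof.
elim: n q q' => [|n IHn] q q'; first by rewrite expn0; lia.
rewrite expnS => qn qn' [bitE /IHn halfE].
have {}halfE : q./2 = q'./2 by apply: halfE; lia.
move: bitE; rewrite /gray_bit halfE => /addIb oddE.
by rewrite -[q]odd_double_half -[q']odd_double_half oddE halfE.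
Qed.

Lemma gray_surj Q v : exists2 q, (Q <= q)%N & gray (size v) q = v.
Proof.
elim: v => [|x v [q Qq IHv]]; first by exists Q.
have xE (b : bool) : (b + q.*2)./2 = q by rewrite half_bit_double.
exists (x (+) ~~ odd q + q.*2)%N; first by lia.
rewrite /= xE IHv /gray_bit xE oddD oddb odd_double addbF.
by rewrite -addbA addbb addbF.
Qed.

Lemma gray_eq q q' : (forall n, gray n q = gray n q') -> q = q'.
Proof.
move=> qq'; have /= big r : (r <= q + q' -> r < 2 ^ (q + q'))%N.
  by move=> rq; apply: leq_ltn_trans rq (ltn_expl _ _).
by apply: gray_inj (qq' (q + q')); apply: big; lia.
Qed.

Lemma line_gen_involutive omega s : involutive (line_gen omega s).
Proof.
move=> q; apply: gray_eq => n; rewrite -!tree_gen_gray.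
rewrite -[LHS]/((tree_gen omega s * tree_gen omega s)%g _).
by rewrite tree_gen_involution.
Qed.

Definition line_word omega (w : seq (option 'I_3)) q : nat :=
  foldr (line_gen omega) q w.

Lemma tree_word_gray omega w n q :
  (\prod_(s <- w) tree_gen omega s)%g (gray n q) = gray n (line_word omega w q).
Proof.
elim: w => [|s w IHw]; first by rewrite big_nil.
by rewrite big_cons /= IHw tree_gen_gray.
Qed.

Lemma tree_word_trivial omega w :
  (\prod_(s <- w) tree_gen omega s = 1)%g -> forall q, line_word omega w q = q.
Proof. by move=> w1 q; apply: gray_eq => n; rewrite -tree_word_gray w1. Qed.

(** Every tree vertex is a prefix of the codes of arbitrarily large numbers, so
    the end of the line can be ignored; far from it, the line looks like the
    points of a subshift. *)
Lemma tree_word_trivial_far omega w Q :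
  (forall q, (Q <= q)%N -> line_word omega w q = q) ->
  (\prod_(s <- w) tree_gen omega s = 1)%g.
Proof.
move=> wQ; apply: selfbijP => v; have [q Qq <-] := gray_surj Q v.
by rewrite tree_word_gray wQ.
Qed.

End HalfLine.

(** * Local moves on a Toeplitz subshift *)

Section Tracking.
Context {A : finType} (L : nat -> A).
Local Notation Y := (toeplitz_subshift L).
Implicit Types (u v : set_type Y) (F G : set_type Y -> set_type Y).

(** F moves a point that looks like the ruler sequence near p as f moves p. The
    constant c is how much of the known window is used up. *)
Definition tracks F (f : nat -> nat) (c : nat) : Prop :=
  forall R u p, looks_like L (R + c) (val u) p ->
    looks_like L R (val (F u)) (f p) /\
    F u = translate (Posz (f p) - Posz p)%R u.

Lemma tracks_comp F G f g c d :
  tracks F f c -> tracks G g d -> tracks (F \o G) (f \o g) (c + d).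
Proof.
move=> Ff Gg R u p; rewrite addnA => /Gg[/Ff[RF FE] GE]; split=> //=.
by rewrite FE GE translateD; congr (translate _ u); rewrite /=; lia.
Qed.

Lemma tracks_involutive F f c : tracks F f c -> involutive f -> involutive F.
Proof.
move=> Ff fK u; have [p up] := toeplitzP u (0 + (c + c)).
have [_] := tracks_comp Ff Ff up.
by rewrite /= fK GRing.subrr translate0.
Qed.

(** The generators need two letters: at the position 2 q, those at distance 0
    and 2 label the two edges of the vertex q. *)
Definition local_move (m : A -> A -> int) u : set_type Y :=
  translate (m (val u 0%R) (val u (Posz 2))) u.

Lemma tracks_local_move m f :
  (forall p, (0 < p)%N ->
    Posz (f p) = (p%:Z + m (ruler L p) (ruler L p.+2))%R) ->
  (forall a b, (`|m a b| <= 2)%N) ->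
  tracks (local_move m) f 2.
Proof.
move=> fE m2 R u p up; have [Rp uE] := up.
have d0 : (p%:Z + m (val u 0%R) (val u (Posz 2)))%R = f p.
  rewrite !uE ?GRing.addr0; [|lia..].
  by rewrite fE; [congr (_ + m _ (ruler L _))%R; lia|lia].
have dE : m (val u 0%R) (val u (Posz 2)) = (Posz (f p) - Posz p)%R by lia.
split; last by rewrite -dE.
rewrite /local_move; apply: (@looks_like_translate _ _ _ _ _ p) => //.
by apply: looks_like_le up; rewrite leq_add2l.
Qed.

Lemma local_involution_full_group m (mK : involutive (local_move m)) :
  (forall a b, (`|m a b| <= 2)%N) ->
  topological_full_group (subshift_map Y) (SelfBij mK mK).
Proof.
move=> m2; have m_loc u v : agree 2 (val u) (val v) ->
    m (val u 0%R) (val u (Posz 2)) = m (val v 0%R) (val v (Posz 2)).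
  by move=> uv; rewrite !uv.
split; last first.
  exists (fun u => m (val u 0%R) (val u (Posz 2))); split=> //.
  exact: continuous_local_discrete m_loc.
suff : continuous (local_move m) by [].
apply: continuous_local_code => i.
exists (2 + `|i|)%N => u v uv; rewrite !val_translate (m_loc u v).
  by apply: uv; have := m2 (val v 0%R) (val v (Posz 2)); lia.
by apply: agree_le uv; lia.
Qed.

End Tracking.

(** * The embedding into the commutator subgroup *)

Section Embedding.
Context (omega : Omega).
Local Open Scope group_scope.

Definition letter : finType := option (option (bool * 'I_3)%type).

(** [None] marks the steps between the two copies of a vertex, [Some None] the
    edges of a, and omega labels the other edges. The parity keeps consecutive
    letters distinct. *)
Definition letter_of (k : nat) : letter :=
  match k with
  | 0 => None
  | 1 => Some None
  | k'.+2 => Some (Some (odd k', omega k'))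
  end.

Lemma letter_of_neq k : letter_of k <> letter_of k.+1.
Proof. by case: k => [|[|k]] //= [+ _]; case: (odd k). Qed.

Local Notation Y := (toeplitz_subshift letter_of).
Local Notation tracks := (tracks (L := letter_of)).

(** An odd position, the second copy of a vertex, is one that shows [None]. *)
Definition swap_rule (l r : letter) : int := if l is None then (-1)%R else 1%R.

Definition swap_step (p : nat) : nat := if odd p then p.-1 else p.+1.

(** At an even position p = 2 q, the letter l read at p belongs to the edge on
    the left of q, and the letter r read at p + 2 to the edge on its right.
    Exactly one of the two is an edge of the generator a. *)
Definition gen_rule (s : option 'I_3) (l r : letter) : int :=
  match l, s with
  | None, _ => 0%R
  | Some None, None => (-2)%R
  | Some (Some _), None => 2%R
  | Some None, Some i =>
      if r is Some (Some (_, j)) then if i != j then 2%R else 0%R else 0%R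
  | Some (Some (_, j)), Some i => if i != j then (-2)%R else 0%R
  end.

Lemma swap_rule_le2 a b : (`|swap_rule a b| <= 2)%N.
Proof. by case: a. Qed.

Lemma gen_rule_le2 s a b : (`|gen_rule s a b| <= 2)%N.
Proof. by case: s a b => [i|] [[[? j]|]|] [[[? j']|]|] //=; case: ifP. Qed.

Definition gen_step (s : option 'I_3) (p : nat) : nat :=
  if odd p then p else (line_gen omega s p./2).*2.

Lemma ruler_letter p : (0 < p)%N -> ruler letter_of p =
  if odd p then None
  else if odd p./2 then Some None
  else Some (Some (odd (logn 2 p./2).-1, omega (logn 2 p./2).-1)).
Proof.
move=> p0; rewrite /ruler absz_nat; case: ifP => [/logn2_odd->//|p_even].
have q0 : (0 < p./2)%N by lia.
have -> : logn 2 p = (logn 2 p./2).+1.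
  by rewrite -logn2_double //; congr (logn 2 _); lia.
case: ifP => [/logn2_odd->//|q_even].
have -> // : logn 2 p./2 = (logn 2 p./2).-1.+1.
have : (0 < logn 2 p./2)%N by rewrite -pfactor_dvdn // expn1 dvdn2 q_even.
by case: logn.
Qed.

Lemma swap_tracks : tracks (local_move (L := letter_of) swap_rule) swap_step 2.
Proof.
apply: tracks_local_move swap_rule_le2 => p p0.
rewrite (ruler_letter p0) /swap_step /swap_rule.
case: ifP => /= p_odd; first by lia.
by case: ifP => _; lia.
Qed.

Lemma gen_tracks s :
  tracks (local_move (L := letter_of) (gen_rule s)) (gen_step s) 2.
Proof.
apply: tracks_local_move (@gen_rule_le2 s) => p p0.
rewrite (ruler_letter p0) (@ruler_letter p.+2) //= negbK /gen_step.
case: (boolP (odd p)) => [_|p_even] /=; first by rewrite GRing.addr0.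
case: s => [i|] /=; case: (boolP (odd p./2)) => [q_odd|q_even] /=; try by lia.
- by case: ifP => _; lia.
- have q0 : (0 < p./2)%N by lia.
  by rewrite q0 /=; case: ifP => _; lia.
Qed.

Lemma swap_stepK : involutive swap_step.
Proof.
by move=> p; rewrite /swap_step; case: (boolP (odd p)); case: ifP; lia.
Qed.

Lemma gen_stepK s : involutive (gen_step s).
Proof.
move=> p; rewrite /gen_step; case: (boolP (odd p)) => [->//|p_even].
by rewrite odd_double doubleK line_gen_involutive; lia.
Qed.

Let swapK := tracks_involutive swap_tracks swap_stepK.
Let genK s := tracks_involutive (@gen_tracks s) (@gen_stepK s).

Definition swap : selfbij (set_type Y) := SelfBij swapK swapK.
Definition gen_even s : selfbij (set_type Y) := SelfBij (genK s) (genK s).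
Definition shift_gen s : selfbij (set_type Y) := [~ gen_even s, swap].

Definition doubled (f : nat -> nat) (p : nat) : nat := (f p./2).*2 + odd p.

Lemma doubled_comp f g p : doubled f (doubled g p) = doubled (f \o g) p.
Proof.
rewrite /doubled /= oddD odd_double oddb addFb.
by congr ((f _).*2 + _)%N; lia.
Qed.

Lemma doubled_id f p : f p./2 = p./2 -> doubled f p = p.
Proof. by rewrite /doubled => ->; lia. Qed.

(** The conjugate of [gen_even s] by [swap], applied first, moves the odd
    positions; [gen_even s] itself then moves the even ones. *)
Lemma shift_gen_tracks s : tracks (shift_gen s) (doubled (line_gen omega s)) 8.
Proof.
have T := tracks_comp (@gen_tracks s)
  (tracks_comp swap_tracks (tracks_comp (@gen_tracks s) swap_tracks)).
suff -> : doubled (line_gen omega s) =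
  gen_step s \o (swap_step \o (gen_step s \o swap_step)) by [].
apply/funext => p; rewrite /doubled /= /gen_step /swap_step.
case: (boolP (odd p)) => [p_odd|p_even].
  have -> /= : odd p.-1 = false by lia.
  rewrite odd_double /=; have -> : p.-1./2 = p./2 by lia.
  by rewrite odd_double addn1.
by rewrite /= !p_even /= (negPf p_even) /= (negPf p_even) addn0.
Qed.

Lemma shift_gen_involution s : shift_gen s * shift_gen s = 1.
Proof.
apply: selfbijP; apply: (tracks_involutive (@shift_gen_tracks s)) => p.
by rewrite doubled_comp doubled_id //= line_gen_involutive.
Qed.

Lemma shift_gen_commutator s :
  commutator_subgroup (topological_full_group (subshift_map Y)) (shift_gen s).
Proof.
move=> H [_]; apply; exists (gen_even s), swap.
split=> //; apply: local_involution_full_group.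
  exact: gen_rule_le2.
exact: swap_rule_le2.
Qed.

Lemma shift_word_tracks w :
  tracks (\prod_(s <- w) shift_gen s)%g (doubled (line_word omega w))
    (size w * 8).
Proof.
elim: w => [|s w IHw].
  by rewrite big_nil => R u p; rewrite addn0 doubled_id // GRing.subrr.
rewrite big_cons mulSn.
have := tracks_comp (@shift_gen_tracks s) IHw.
by rewrite (_ : _ \o _ = doubled (line_word omega (s :: w))) //;
  apply/funext => p; apply: doubled_comp.
Qed.

Lemma word_trivial_iff w :
  \prod_(s <- w) tree_gen omega s = 1 <-> \prod_(s <- w) shift_gen s = 1.
Proof.
have track := @shift_word_tracks w; split=> w1.
  apply: selfbijP => u; have [p up] := toeplitzP u (0 + size w * 8).
  have [_ ->] := track _ _ _ up.
  by rewrite doubled_id ?(tree_word_trivial w1) // GRing.subrr.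
apply: (@tree_word_trivial_far _ _ (size w * 8).+1) => q wq.
(* The line far from its end is visible in Y: some translate of any point looks
   like it near 2 q. *)
have [u0 _] := toeplitz_nonempty letter_of.
have far : (0 + size w * 8 < q.*2)%N by lia.
have [i up] := toeplitz_recurrence u0 far.
have [_] := track _ _ _ up; rewrite w1.
move=> /esym /(toeplitz_aperiodic letter_of_neq).
by rewrite /doubled doubleK odd_double; lia.
Qed.

End Embedding.

Theorem corollary4p4 (omega : Omega) :
  exists (A : finType) (Y : subshift A),
    minimal_subshift Y /\
    embeds (grigorchuk_group omega)
           (commutator_subgroup (topological_full_group (subshift_map Y))).
Proof.
exists letter, (toeplitz_subshift (letter_of omega)); split.
  exact: toeplitz_minimal (@letter_of_neq omega).
rewrite grigorchuk_groupE; apply: (embeds_by_words (f := @shift_gen omega)).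
- exact: tree_gen_involution.
- exact: shift_gen_involution.
- exact: generated_subgroup_closed.
- exact: shift_gen_commutator.
- exact: word_trivial_iff.
Qed.
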